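(* Let $n\ge 1$ and let $m\ge0$ be an integer. Then \begin{align*} \mathrm{pz}_m(z_1,\ldots,z_n)&=\sum_{j=1}^n2\mathcal{T}_m(z_j/2),\\ \mathrm{pz}_m(z_1,\ldots,z_n)&= \begin{cases} \displaystyle m\sum_{j=0}^{\lfloor m/2\rfloor}\frac{(-1)^j}{m-j}\binom{m-j}{j}\,\mathrm{p}_{m-2j}(z_1,\ldots,z_n),& m\ge1,\\[1ex] 2\,\mathrm{p}_0(z_1,\ldots,z_n),& m=0, \end{cases}\\ \mathrm{p}_m(z_1,\ldots,z_n)&=\sum_{k=0}^{\lfloor m/2\rfloor}\alpha_{m,k}\,\mathrm{pz}_{m-2k}(z_1,\ldots,z_n), \end{align*} where $\alpha_{m,k}=\binom{m}{k}$ if $k<\frac m2$, and $\alpha_{m,k}=\frac12\binom{m}{m/2}$ if $k=\frac m2$.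
   Context: $\mathcal{T}_m$ are the Chebyshev polynomials of the first kind. $\operatorname{Sym}_N$ is the algebra of symmetric polynomials in $N$ variables over $\mathbb{C}$. For $P\in\operatorname{Sym}_{2n}$, $\Phi_n(P)$ is the unique $Q\in\operatorname{Sym}_n$ with $P(x_1,\ldots,x_n,x_1^{-1},\ldots,x_n^{-1})=Q(x_1+x_1^{-1},\ldots,x_n+x_n^{-1})$ (existence and uniqueness hold). $\mathrm{p}_m$ denotes the power sum $\mathrm{p}_m(y_1,\ldots,y_N)=\sum_{j=1}^N y_j^m$ (in $N$ variables, denoted $\mathrm{p}_m^{(N)}$), and $\mathrm{pz}_m=\Phi_n(\mathrm{p}_m^{(2n)})$; in particular $\mathrm{p}_0(z_1,\ldots,z_n)=n$ and $\mathrm{pz}_0(z_1,\ldots,z_n)=2n$. *)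

(* Defs.v *)
From mathcomp Require Import all_boot all_order all_algebra.
From mathcomp Require Import classical_sets reals.
From mathcomp Require Import complex mpoly.

Set Implicit Arguments.
Unset Strict Implicit.
Unset Printing Implicit Defensive.

Import GRing.Theory.
Local Open Scope ring_scope.

Fixpoint chebyshevT (K : nzRingType) (m : nat) : {poly K} :=
  match m with
  | 0 => 1
  | 1 => 'X
  | (k.+1 as l).+1 => 2%:R *: ('X * chebyshevT K l) - chebyshevT K k
  end.
Arguments chebyshevT : clear implicits.

(* Since x ^+ 0 = 1, powersum K N 0 is the constant N. *)
Definition powersum (K : nzRingType) (N m : nat) : {mpoly K[N]} :=
  \sum_(j < N) 'X_j ^+ m.
Arguments powersum : clear implicits.

(* The point (x_1, ..., x_n, x_1^-1, ..., x_n^-1). *)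
Definition join_inv (K : fieldType) (n : nat) (x : 'I_n -> K) : 'I_(n + n) -> K :=
  fun i => match split i with inl j => x j | inr j => (x j)^-1 end.

(* For a realType R, R[i] is the field of complex numbers. The identity
   P(x, x^-1) = Q(x + x^-1) of Laurent polynomials is read as an equality at
   all points x with nonzero complex coordinates; the nonvanishing hypothesis
   is needed because 0^-1 = 0. *)
Definition is_Phi (R : realType) (n : nat)
    (P : {mpoly R[i][n + n]}) (Q : {mpoly R[i][n]}) : Prop :=
  Q \is symmetric /\
  forall x : 'I_n -> R[i], (forall j, x j != 0) ->
    P.@[join_inv x] = Q.@[fun j => x j + (x j)^-1].

(* Symmetric polynomials are the elements of {mpoly _} satisfying
   [symmetric]; Phi is only meaningful for symmetric P, for which the Q chosen
   here exists and is unique. *)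
Definition Phi (R : realType) (n : nat) (P : {mpoly R[i][n + n]}) :
    {mpoly R[i][n]} :=
  xget 0 (is_Phi P).

Definition pz (R : realType) (n m : nat) : {mpoly R[i][n]} :=
  Phi (powersum R[i] (n + n) m).
Arguments pz : clear implicits.

(* Only used for k <= m / 2, so the last branch is the case k = m / 2. *)
Definition alpha (K : fieldType) (m k : nat) : K :=
  if (k.*2 < m)%N then 'C(m, k)%:R else 2%:R^-1 * 'C(m, m./2)%:R.
Arguments alpha : clear implicits.

(* Main.v *)
Require Import Defs.
From mathcomp Require Import all_boot all_order all_algebra.
From mathcomp Require Import perm.
From mathcomp Require Import reals.
From mathcomp Require Import classical_sets boolp.
From mathcomp Require Import ring zify.
From mathcomp Require Import complex mpoly.
Import GRing.Theory.
Local Open Scope ring_scope.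

(** Everything is checked at points z_j = x_j + 1/x_j with all x_j nonzero.
    Over an algebraically closed field such points exhaust affine n-space, and
    a polynomial over an infinite field that vanishes everywhere is zero, so
    identities between polynomials in z_1, ..., z_n may be tested there
    ([joukowski_inj]). This also makes [Phi] single-valued ([Phi_eq]).

    The defining property of [pz] is that its value at such a point is the sum
    over j of x_j^m + x_j^-m. Each of the three formulas thus reduces to an
    identity in a single nonzero x, with y = x + 1/x:
    - 2 T_m (y / 2) = x^m + x^-m, because both sides satisfy the recurrence
      s_(m+2) = y s_(m+1) - s_m ([chebyshevT_joukowski]);
    - Waring's expansion of x^m + x^-m in powers of y ([waring]), obtained from
      x^m + x^-m = U_m - U_(m-2), where U_m is the Chebyshev polynomial of the
      second kind at y / 2, whose coefficients are signed binomials;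
    - the inverse expansion of y^m ([expr_joukowski]), which is the binomial
      theorem with the terms k and m - k grouped together.

    The existence half of the definition of [pz] comes from Waring's expansion:
    its right-hand side is a combination of power sums, hence symmetric
    ([pz_expansion_is_Phi]). *)

(** * Polynomials vanishing at all points *)

Lemma polyfun_eq0 (K : numFieldType) (p : {poly K}) :
  (forall c, p.[c] = 0) -> p = 0.
Proof.
move=> p0.
apply: (@roots_geq_poly_eq0 _ p [seq i%:R | i <- iota 0 (size p)]).
- by apply/allP => c _; apply/rootP.
- rewrite map_inj_uniq ?iota_uniq // => i j /eqP.
  by rewrite Num.Theory.eqr_nat => /eqP.
- by rewrite size_map size_iota.
Qed.

Lemma meval_muni (K : comNzRingType) (n : nat) (p : {mpoly K[n.+1]})
    (v : 'I_n.+1 -> K) :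
  p.@[v] =
  (map_poly (meval (fun i => v (widen_ord (leqnSn n) i))) (muni p)).[v ord_max].
Proof.
rewrite muniE mevalE rmorph_sum horner_sum; apply: eq_bigr => m _ /=.
rewrite !map_polyZ /= map_polyXn hornerZ hornerXn mevalZ mevalX.
rewrite big_ord_recr /= mulrA.
by congr (_ * _ * _); apply: eq_bigr => i _; rewrite mnmE.
Qed.

(** Makes [muni] injective: every coefficient of [p] can be read off it. *)
Lemma coef_muni (K : comNzRingType) (n : nat) (p : {mpoly K[n.+1]})
    (m : 'X_{1..n.+1}) :
  p@_m =
  ((muni p)`_(m ord_max))@_[multinom m (widen_ord (leqnSn n) i) | i < n].
Proof.
rewrite muniE coef_sum raddf_sum {1}[p]mpolyE raddf_sum /=.
apply: eq_bigr => u _; rewrite !coefZ coefXn mulr_natr mcoeffZ mcoeffX.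
have -> : (u == m) = (m ord_max == u ord_max) &&
  ([multinom u (widen_ord (leqnSn n) i) | i < n] ==
   [multinom m (widen_ord (leqnSn n) i) | i < n]).
  apply/eqP/andP => [-> // | [/eqP um /eqP /mnmP uw]].
  apply/mnmP => i; have [lt_in|le_ni] := ltnP i n.
    have := uw (Ordinal lt_in); rewrite !mnmE.
    by congr (u _ = m _); apply: val_inj.
  have -> // : i = ord_max.
  by apply: val_inj => /=; have := ltn_ord i; lia.
case: (_ == _) => /=; first by rewrite mulr1n mcoeffZ mcoeffX.
by rewrite mulr0n mcoeff0 mulr0.
Qed.

(** Induction on the number of variables: with the first [n] coordinates
    fixed, [muni p] becomes a univariate polynomial function vanishing
    identically, so each of its coefficients vanishes at every point of
    n-space. *)
Lemma mpolyfun_eq0 (K : numFieldType) (n : nat) (p : {mpoly K[n]}) :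
  (forall v, p.@[v] = 0) -> p = 0.
Proof.
elim: n p => [|n IHn] p p0.
  by have := p0 (fun=> 0); rewrite [p]nvar0_mpolyC mevalC => ->; rewrite mpolyC0.
apply/mpolyP => m; rewrite coef_muni mcoeff0.
suff -> : (muni p)`_(m ord_max) = 0 by rewrite mcoeff0.
apply: IHn => v; rewrite -(coef_map (meval v)).
suff -> : map_poly (meval v) (muni p) = 0 by rewrite coef0.
apply: polyfun_eq0 => c.
pose w (i : 'I_n.+1) := if insub (val i) is Some j then v j else c.
rewrite -[RHS](p0 w) meval_muni /w /= insubN ?ltnn //; congr _.[_].
apply: eq_map_poly => q; apply: meval_eq => j /=.
by rewrite insubT //= => lt_jn; congr v; apply: val_inj.
Qed.

(** * Testing identities at the points x + 1/x *)

(** [x] is a root of X^2 - z X + 1, whose constant term forces [x != 0]. *)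
Lemma joukowski_surj (K : closedFieldType) (z : K) :
  exists2 x, x != 0 & z = x + x^-1.
Proof.
have : size ('X^2 - z *: 'X + 1 : {poly K}) != 1%N.
  rewrite -addrA size_polyDl size_polyXn //.
  apply: leq_ltn_trans (size_polyD _ _) _.
  rewrite gtn_max size_polyN size_poly1 andbT.
  by rewrite (leq_ltn_trans (size_scale_leq _ _)) ?size_polyX.
case/closed_rootP => x /rootP; rewrite !hornerE => x0.
have nz_x : x != 0.
  apply: contra_eqN x0 => /eqP ->.
  by rewrite expr0n mulr0 subr0 add0r oner_neq0.
exists x => //.
have -> : z = (z * x) / x by rewrite mulfK.
have -> : z * x = x ^+ 2 + 1 by rewrite -[LHS]addr0 -x0; ring.
by field.
Qed.

Lemma joukowski_inj (K : numClosedFieldType) (n : nat) (P Q : {mpoly K[n]}) :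
  (forall x : 'I_n -> K, (forall j, x j != 0) ->
     P.@[fun j => x j + (x j)^-1] = Q.@[fun j => x j + (x j)^-1]) ->
  P = Q.
Proof.
move=> PQ; apply/eqP; rewrite -subr_eq0; apply/eqP.
apply: mpolyfun_eq0 => v.
have [x x0 xv] := all_sig2 (fun j => cid2 (joukowski_surj K (v j))).
by rewrite mevalB !(meval_eq _ xv) PQ // subrr.
Qed.

Lemma Phi_eq (R : realType) (n : nat)
    (P : {mpoly R[i][n + n]}) (Q : {mpoly R[i][n]}) :
  is_Phi P Q -> Phi P = Q.
Proof.
move=> PQ; apply: xget_unique => // Q' [_ PQ'].
by apply: joukowski_inj => x x0; rewrite -PQ' // PQ.2.
Qed.

Lemma powersum_sym (K : fieldType) n m : powersum K n m \is symmetric.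
Proof.
apply/issymP => s; rewrite raddf_sum /=.
rewrite [RHS](reindex_inj (@perm_inj _ s)) /=.
apply: eq_bigr => j _; rewrite rmorphXn /=; congr (_ ^+ _).
by rewrite /msym mmapX mmap1U.
Qed.

Lemma powersum_meval (K : fieldType) n m (v : 'I_n -> K) :
  (powersum K n m).@[v] = \sum_(j < n) v j ^+ m.
Proof.
by rewrite raddf_sum /=; apply: eq_bigr => j _; rewrite rmorphXn /= mevalXU.
Qed.

Lemma powersum_join_inv (K : fieldType) n m (x : 'I_n -> K) :
  (powersum K (n + n) m).@[join_inv x] = \sum_(j < n) (x j ^+ m + x j ^- m).
Proof.
rewrite powersum_meval big_split_ord /= big_split /=.
congr (_ + _); apply: eq_bigr => j _; rewrite /join_inv.
  by rewrite (unsplitK (inl j)).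
by rewrite (unsplitK (inr j)) exprVn.
Qed.

Lemma meval_horner_alg (K : fieldType) n (v : 'I_n -> K) (a : {mpoly K[n]})
    (p : {poly K}) :
  (horner_alg a p).@[v] = p.[a.@[v]].
Proof.
elim/poly_ind: p => [|p c IH]; first by rewrite !rmorph0 horner0.
rewrite rmorphD rmorphM /= horner_algX horner_algC mevalD mevalM IH.
by rewrite mevalZ meval1 mulr1 !hornerE.
Qed.

(** * Identities in one variable *)

Lemma powerV_rec (K : fieldType) m (x : K) : x != 0 ->
  x ^+ m.+2 + x ^- m.+2 =
  (x + x^-1) * (x ^+ m.+1 + x ^- m.+1) - (x ^+ m + x ^- m).
Proof. by move=> x0; rewrite -!exprVn !exprS; field. Qed.

(** The Chebyshev recurrence at y / 2, doubled, is [powerV_rec]. *)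
Lemma chebyshevT_joukowski (K : fieldType) m (x : K) :
  2%:R != 0 :> K -> x != 0 ->
  2%:R * (chebyshevT K m).[2%:R^-1 * (x + x^-1)] = x ^+ m + x ^- m.
Proof.
move=> two0 x0.
suff [] : 2%:R * (chebyshevT K m).[2%:R^-1 * (x + x^-1)] = x ^+ m + x ^- m /\
  2%:R * (chebyshevT K m.+1).[2%:R^-1 * (x + x^-1)] = x ^+ m.+1 + x ^- m.+1
  by [].
elim: m => [|m [IH0 IH1]].
  rewrite /= hornerX hornerC !expr0 !expr1 invr1.
  by split; field; rewrite ?x0.
split=> //; rewrite powerV_rec // -IH0 -IH1.
have -> : chebyshevT K m.+2 =
  2%:R *: ('X * chebyshevT K m.+1) - chebyshevT K m by [].
rewrite hornerD hornerN hornerZ hornerM hornerX mulrBr; congr (_ - _).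
by rewrite !mulrA mulfK // [2%:R * _]mulrC.
Qed.

(** The value U_m (y / 2) of the Chebyshev polynomial of the second kind. The
    terms with [m < 2 * j] have a vanishing binomial; letting [j] run up to [m]
    keeps the parity of [m] out of the recurrence. *)
Definition chebyshevU_half (K : nzRingType) (m : nat) (y : K) : K :=
  \sum_(j < m.+1) (-1) ^+ j * 'C(m - j, j)%:R * y ^+ (m - j.*2).
Arguments chebyshevU_half : clear implicits.

(** Pascal's rule applied to each coefficient. *)
Lemma chebyshevU_half_rec (K : comNzRingType) m (y : K) :
  chebyshevU_half K m.+2 y =
  y * chebyshevU_half K m.+1 y - chebyshevU_half K m y.
Proof.
rewrite /chebyshevU_half big_ord_recl big_ord_recr.
rewrite [in X in y * X]big_ord_recl /= expr0 bin0 subn0.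
rewrite (@bin_small (m.+2 - bump 0 m.+1)); last by rewrite /bump; lia.
rewrite mulr0 mul0r addr0 !mul1r mulrDr -exprS -addrA; congr (_ + _).
rewrite mulr_sumr -sumrB; apply: eq_bigr => j _.
rewrite /bump leq0n !add1n doubleS !subSS.
have le_jm : (j <= m)%N by have := ltn_ord j; lia.
rewrite subSn // binS natrD exprS.
have [le_2jm|lt_m2j] := leqP j.+1.*2 m.+1.
  have -> : (m - j.*2)%N = (m.+1 - j.+1.*2).+1 by lia.
  by rewrite exprS; ring.
by rewrite (@bin_small (m - j) j.+1) ?add0r; [ring | lia].
Qed.

(** The relation 2 T_m = U_m - U_(m-2): both sides obey the same two-step
    recurrence. *)
Lemma powerV_chebyshevU_half (K : fieldType) m (x : K) : x != 0 ->
  x ^+ m.+2 + x ^- m.+2 =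
  chebyshevU_half K m.+2 (x + x^-1) - chebyshevU_half K m (x + x^-1).
Proof.
move=> x0; set y := x + x^-1; set U := fun k => chebyshevU_half K k y.
have Urec k : U k.+2 = y * U k.+1 - U k by apply: chebyshevU_half_rec.
have U0 : U 0%N = 1 by rewrite /U /chebyshevU_half big_ord1 /= !mulr1.
have U1 : U 1%N = y.
  rewrite /U /chebyshevU_half !big_ord_recr big_ord0 /= bin0.
  by rewrite (@bin_small (1 - 1)) // mulr0 mul0r addr0 add0r !mul1r.
suff [] : x ^+ m.+2 + x ^- m.+2 = U m.+2 - U m /\
          x ^+ m.+3 + x ^- m.+3 = U m.+3 - U m.+1 by [].
elim: m => [|m [IH0 IH1]].
  by rewrite !Urec U0 U1 /y -!exprVn !exprS; split; field.
split=> //; rewrite powerV_rec // IH0 IH1 -/y (Urec m.+2) (Urec m); ring.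
Qed.

(** In U_m - U_(m-2) the coefficient of y^(m-2j) is, up to sign, the sum of
    C(m-j, j) and C(m-j-1, j-1); by absorption the latter is j / (m-j) times
    the former, so the sum is m / (m-j) C(m-j, j). *)
Lemma waring (K : numFieldType) m (x : K) : x != 0 -> (0 < m)%N ->
  x ^+ m + x ^- m =
  m%:R * \sum_(j < (m./2).+1)
            ((-1) ^+ j / (m - j)%:R * 'C(m - j, j)%:R)
              * (x + x^-1) ^+ (m - j.*2).
Proof.
move=> x0; case: m => [//|[|m]] _.
  by rewrite big_ord1 /= expr0 subn0 bin0 !expr1 divr1 !mul1r.
rewrite powerV_chebyshevU_half //; set y := x + x^-1.
rewrite /chebyshevU_half big_ord_recl big_ord_recr /= subn0.
rewrite (@bin_small (m.+2 - bump 0 m.+1)); last by rewrite /bump; lia.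
rewrite mulr0 mul0r addr0 expr0 bin0 !mul1r.
rewrite [in RHS]big_ord_recl /= expr0 bin0 subn0 mulr1 mulrDr.
rewrite -addrA mul1r mulVKf ?Num.Theory.pnatr_eq0 //; congr (_ + _).
rewrite -sumrB mulr_sumr.
(* The leading terms have been cancelled, so j counts from one less. *)
pose F j := m.+2%:R * ((-1) ^+ j.+1 / (m.+1 - j)%:R * 'C(m.+1 - j, j.+1)%:R
                         * y ^+ (m - j.*2)).
transitivity (\sum_(j < m.+1) F j).
  apply: eq_bigr => j _; rewrite /bump leq0n !add1n doubleS !subSS /F.
  have le_jm : (j <= m)%N by have := ltn_ord j; lia.
  have nz : (m.+1 - j)%:R != 0 :> K by rewrite Num.Theory.pnatr_eq0; lia.
  have E : (m.+1 - j)%:R * 'C(m - j, j)%:R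
             = j.+1%:R * 'C(m.+1 - j, j.+1)%:R :> K.
    by rewrite -!natrM -mul_bin_diag subSn.
  have -> : 'C(m - j, j)%:R
              = j.+1%:R * 'C(m.+1 - j, j.+1)%:R / (m.+1 - j)%:R :> K.
    by rewrite -E mulrAC mulfV // mul1r.
  have -> : m.+2%:R = (m.+1 - j)%:R + j.+1%:R :> K.
    by rewrite -natrD; congr _%:R; lia.
  by rewrite exprS; field.
have le_half : (m./2.+1 <= m.+1)%N by lia.
under [RHS]eq_bigr => j _ do rewrite /bump leq0n !add1n doubleS !subSS -/(F j).
rewrite (big_ord_widen _ F le_half) [RHS]big_mkcond; apply: eq_bigr => j _.
case: ifP => // lt_mj; rewrite /F bin_small ?mulr0 ?mul0r ?mulr0 //.
by have := odd_double_half m; lia.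
Qed.

Lemma big_ord_fold (V : nmodType) m (F : nat -> V) :
  \sum_(i < m.+1) F i =
  \sum_(k < (m./2).+1) (if (k.*2 < m)%N then F k + F (m - k)%N else F k).
Proof.
elim/ltn_ind: m F => [[|[|m]]] IH F.
- by rewrite !big_ord1.
- by rewrite big_ord_recr !big_ord1.
(* Peel off both end terms, then fold the shifted inner sum. *)
rewrite big_ord_recl big_ord_recr /= [RHS]big_ord_recl /= subn0.
rewrite (IH m _ (fun i => F (bump 0 i))) //.
rewrite addrCA addrC /bump /= add1n; congr (_ + _); apply: eq_bigr => k _ /=.
rewrite !add1n doubleS !ltnS subSS subSn //.
by have := ltn_ord k; have := odd_double_half m; lia.
Qed.

(** Terms [k] and [m - k] of the binomial expansion are C(m, k) times
    x^(m-2k) and x^-(m-2k). The middle term, which has no partner, is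
    C(m, m/2) = 1/2 C(m, m/2) (x^0 + x^-0): hence the factor 1/2 in [alpha]. *)
Lemma expr_joukowski (K : fieldType) m (x : K) : 2%:R != 0 :> K -> x != 0 ->
  (x + x^-1) ^+ m =
  \sum_(k < (m./2).+1) alpha K m k * (x ^+ (m - k.*2) + x ^- (m - k.*2)).
Proof.
move=> two0 x0.
rewrite exprDn (big_ord_fold _ m (fun i => x ^+ (m - i) * x^-1 ^+ i *+ 'C(m, i))).
apply: eq_bigr => k _; rewrite /alpha; case: ifP => [lt_km|ge_km].
  have le_km : (k <= m)%N by lia.
  rewrite bin_sub // subKn // -mulrnDl -[LHS]mulr_natl; congr (_ * (_ + _)).
    have -> : (m - k = (m - k.*2) + k)%N by lia.
    by rewrite exprD -mulrA exprVn mulfV ?mulr1 // expf_neq0.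
  have -> : (m - k = (m - k.*2) + k)%N by lia.
  by rewrite exprD mulrCA -exprMn mulfV // expr1n mulr1 exprVn.
case: k ge_km => k /= lt_k ge_km.
have -> : (m - k = k)%N by lia.
have -> : (m - k.*2 = 0)%N by lia.
have -> : m./2 = k by lia.
rewrite expr0 invr1 -mulr_natl -exprMn mulfV // expr1n.
by field.
Qed.

(** * The polynomials pz *)

Definition pz_expansion (K : fieldType) (n m : nat) : {mpoly K[n]} :=
  if (1 <= m)%N then
    m%:R *: \sum_(j < (m./2).+1)
      ((-1) ^+ j / (m - j)%:R * 'C(m - j, j)%:R) *: powersum K n (m - j.*2)
  else 2%:R *: powersum K n 0.
Arguments pz_expansion : clear implicits.

Lemma pz_expansion_is_Phi (R : realType) n m :
  is_Phi (powersum R[i] (n + n) m) (pz_expansion R[i] n m).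
Proof.
rewrite /pz_expansion; split=> [|x x0].
  case: ifP => _; rewrite rpredZ ?powersum_sym //.
  by apply: rpred_sum => j _; rewrite rpredZ ?powersum_sym.
rewrite powersum_join_inv; case: ifP => [m_gt0|]; last first.
  move/negbT; rewrite -eqn0Ngt => /eqP ->.
  rewrite mevalZ powersum_meval mulr_sumr.
  by apply: eq_bigr => j _; rewrite !expr0 invr1 mulr1.
rewrite mevalZ raddf_sum /=.
under [in RHS]eq_bigr do rewrite mevalZ powersum_meval mulr_sumr.
rewrite exchange_big mulr_sumr; apply: eq_bigr => j _ /=.
exact: waring.
Qed.

Lemma pzE (R : realType) n m : pz R n m = pz_expansion R[i] n m.
Proof. exact/Phi_eq/pz_expansion_is_Phi. Qed.

Lemma pz_joukowski (R : realType) n m (x : 'I_n -> R[i]) :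
  (forall j, x j != 0) ->
  (pz R n m).@[fun j => x j + (x j)^-1] = \sum_(j < n) (x j ^+ m + x j ^- m).
Proof.
move=> x0; rewrite pzE -powersum_join_inv.
by have [_ ->] := pz_expansion_is_Phi R n m.
Qed.

Theorem theorem1p6 (R : realType) (n : nat) (hn : (1 <= n)%N) (m : nat) :
  [/\ pz R n m =
        \sum_(j < n)
          2%:R *: horner_alg (2%:R^-1 *: ('X_j : {mpoly R[i][n]}))
                             (chebyshevT R[i] m),
      pz R n m =
        (if (1 <= m)%N then
           m%:R *: \sum_(j < (m./2).+1)
             ((-1) ^+ j / (m - j)%:R * 'C(m - j, j)%:R)
               *: powersum R[i] n (m - j.*2)
         else 2%:R *: powersum R[i] n 0)
    & powersum R[i] n m =
        \sum_(k < (m./2).+1) alpha R[i] m k *: pz R n (m - k.*2)].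
Proof.
have two0 : 2%:R != 0 :> R[i] by rewrite Num.Theory.pnatr_eq0.
split.
- apply: joukowski_inj => x x0; rewrite pz_joukowski // raddf_sum /=.
  apply: eq_bigr => j _.
  by rewrite mevalZ meval_horner_alg mevalZ mevalXU chebyshevT_joukowski.
- exact: pzE.
- apply: joukowski_inj => x x0; rewrite powersum_meval raddf_sum /=.
  under [RHS]eq_bigr do rewrite mevalZ pz_joukowski // mulr_sumr.
  by rewrite exchange_big; apply: eq_bigr => j _; exact: expr_joukowski.
Qed.
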